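(* Let $k$ be a division ring and let $A=(a_{ij})\in\mathrm{Mat}(n,k)$. Then there exist elements $\lambda_1,\ldots,\lambda_n\in k$ that do not depend on the first row of $A$ such that $$\det A=[a_{11}\lambda_1+\cdots+a_{1n}\lambda_n]$$ and $$[\lambda_i]=\det A(1,i),$$ where $A(i,j)\in\mathrm{Mat}(n-1,k)$ is the matrix $A$ with the $i$th row and $j$th column deleted.
   Context: $\mathrm{Mat}(n,k)$ is the set of $n\times n$ matrices with entries in the (not necessarily commutative) division ring $k$. $k^\times$ is the multiplicative group of non-zero elements of $k$, and $[k^\times,k^\times]$ is its commutator subgroup. To the group $k^\times/[k^\times,k^\times]$ one adjoins a zero element $0$ with the obvious multiplication rules. $[a]$ denotes the coset of $a\in k^\times$ in $k^\times/[k^\times,k^\times]$, and $[0]=0$. $\det$ is the Dieudonné determinant: the unique map $\det\colon\mathrm{Mat}(n,k)\to k^\times/[k^\times,k^\times]\cup\{0\}$ such that (a) if $A'$ is obtained from $A$ by multiplying one row from the left by $\mu$, then $\det A'=[\mu]\det A$; (b) if $A'$ is obtained from $A$ by adding a left multiple of a row to another row, then $\det A'=\det A$; (c) the unit matrix has determinant $1$. If $k$ is commutative, the Dieudonné determinant coincides with the usual determinant.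
   Formalization: The printed formula [λ_i] = det A(1,i) lacks the cofactor sign and fails for k = Q, A = [[0,1],[1,0]]; the formal statement proves [λ_i] = [(-1)^{i-1}] det A(1,i) for i = 1,…,n, which is the printed formula when [-1] = [1]. *)

(* Defs.v *)
From HB Require Import structures.
From mathcomp Require Import all_boot all_order all_algebra.
From mathcomp Require Import boolp.
Set Implicit Arguments.
Unset Strict Implicit.
Unset Printing Implicit Defensive.
Import GRing.Theory.
Local Open Scope ring_scope.

(* There is no division-ring structure between unitRingType and fieldType:
   this is the field axiom without commutativity. *)
Definition division_ring (k : unitRingType) : Prop :=
  forall x : k, x != 0 -> x \is a GRing.unit.

(* The abelianization G / [G, G] of a possibly infinite group *)

Inductive commutator_subgroup (G : groupType) : G -> Prop :=
| CommSub1 : commutator_subgroup 1%g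
| CommSubR x y : commutator_subgroup (x^-1 * y^-1 * x * y)%g
| CommSubM x y : commutator_subgroup x -> commutator_subgroup y ->
    commutator_subgroup (x * y)%g
| CommSubV x : commutator_subgroup x -> commutator_subgroup x^-1%g.

Section Abelianization.
Variable G : groupType.
Local Open Scope group_scope.
Local Open Scope quotient_scope.

Lemma commutator_subgroupJ (x y : G) :
  commutator_subgroup x -> commutator_subgroup (y^-1 * x * y).
Proof.
move=> cx; have -> : y^-1 * x * y = x * (x^-1 * y^-1 * x * y).
  by rewrite !mulgA mulgV mul1g.
by apply: CommSubM => //; apply: CommSubR.
Qed.

Definition same_coset (x y : G) : bool := `[< commutator_subgroup (x^-1 * y) >].

Lemma same_coset_refl : reflexive same_coset.
Proof. by move=> x; apply/asboolP; rewrite mulVg; apply: CommSub1. Qed.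

Lemma same_coset_sym : symmetric same_coset.
Proof.
by move=> x y; apply/asboolP/asboolP => /CommSubV; rewrite invgM invgK.
Qed.

Lemma same_coset_trans : transitive same_coset.
Proof.
move=> y x z /asboolP cxy /asboolP cyz; apply/asboolP.
by have := CommSubM cxy cyz; rewrite mulgA mulgK.
Qed.

Canonical same_coset_equiv :=
  EquivRel same_coset same_coset_refl same_coset_sym same_coset_trans.

Definition abelianization : Type := {eq_quot same_coset}.
HB.instance Definition _ := EqQuotient.on abelianization.
HB.instance Definition _ := Choice.on abelianization.

Definition ab_one : abelianization := \pi_abelianization 1.
Definition ab_inv (X : abelianization) : abelianization :=
  \pi_abelianization (repr X)^-1.
Definition ab_mul (X Y : abelianization) : abelianization :=
  \pi_abelianization (repr X * repr Y).

Lemma same_cosetP (x y : G) :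
  reflect (commutator_subgroup (x^-1 * y))
    (\pi_abelianization x == \pi_abelianization y).
Proof. by rewrite eqmodE; apply: asboolP. Qed.

Lemma ab_repr (x : G) : commutator_subgroup (x^-1 * repr (\pi_abelianization x)).
Proof. by apply/same_cosetP; rewrite reprK. Qed.

Lemma ab_piM (x y : G) :
  \pi_abelianization (x * y) = ab_mul (\pi_abelianization x) (\pi_abelianization y).
Proof.
apply/eqP/same_cosetP.
set x' := repr _; set y' := repr _.
have -> : (x * y)^-1 * (x' * y') = (y^-1 * (x^-1 * x') * y) * (y^-1 * y').
  by rewrite invgM !mulgA mulgK.
by apply: CommSubM (ab_repr y); apply: commutator_subgroupJ; apply: ab_repr.
Qed.

Lemma ab_piV (x : G) : \pi_abelianization x^-1 = ab_inv (\pi_abelianization x).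
Proof.
apply/eqP/same_cosetP; rewrite invgK; set x' := repr _.
have -> : x * x'^-1 = (x^-1)^-1 * (x^-1 * x')^-1 * x^-1.
  by rewrite invgM !invgK !mulgA mulgK.
by apply: commutator_subgroupJ; apply: CommSubV; apply: ab_repr.
Qed.

Lemma ab_mulA : associative ab_mul.
Proof.
elim/quotW=> x; elim/quotW=> y; elim/quotW=> z.
by rewrite -(ab_piM y z) -(ab_piM x) -(ab_piM x y) -(ab_piM _ z) mulgA.
Qed.

Lemma ab_mul1 : left_id ab_one ab_mul.
Proof. by elim/quotW=> x; rewrite -(ab_piM 1 x) mul1g. Qed.

Lemma ab_mulr1 : right_id ab_one ab_mul.
Proof. by elim/quotW=> x; rewrite -(ab_piM x 1) mulg1. Qed.

Lemma ab_mulV : left_inverse ab_one ab_inv ab_mul.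
Proof. by elim/quotW=> x; rewrite -(ab_piV x) -(ab_piM x^-1 x) mulVg. Qed.

Lemma ab_mulrV : right_inverse ab_one ab_inv ab_mul.
Proof. by elim/quotW=> x; rewrite -(ab_piV x) -(ab_piM x x^-1) mulgV. Qed.

HB.instance Definition _ := isGroup.Build abelianization
  ab_mulA ab_mul1 ab_mulr1 ab_mulV ab_mulrV.

End Abelianization.

(* The multiplicative group k^* of a possibly infinite ring *)

Section Units.
Variable k : unitRingType.

Definition units : Type := {x : k | x \is a GRing.unit}.
HB.instance Definition _ := SubChoice.on units.

Definition units_one : units := Sub 1 (unitr1 k).
Definition units_inv (u : units) : units :=
  Sub (\val u)^-1 (etrans (unitrV _) (valP u)).
Definition units_mul (u v : units) : units :=
  Sub (\val u * \val v) (etrans (unitrMr _ (valP u)) (valP v)).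

Lemma units_mulA : associative units_mul.
Proof. by move=> u v w; apply: val_inj; rewrite /= mulrA. Qed.
Lemma units_mul1 : left_id units_one units_mul.
Proof. by move=> u; apply: val_inj; rewrite /= mul1r. Qed.
Lemma units_mulr1 : right_id units_one units_mul.
Proof. by move=> u; apply: val_inj; rewrite /= mulr1. Qed.
Lemma units_mulV : left_inverse units_one units_inv units_mul.
Proof. by move=> u; apply: val_inj; rewrite /= mulVr // (valP u). Qed.
Lemma units_mulrV : right_inverse units_one units_inv units_mul.
Proof. by move=> u; apply: val_inj; rewrite /= mulrV // (valP u). Qed.

HB.instance Definition _ := isGroup.Build units
  units_mulA units_mul1 units_mulr1 units_mulV units_mulrV.

(* k^*/[k^*, k^*] with a zero adjoined; None is the zero. *)
Definition coset0 : Type := option (abelianization units).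

Definition coset0_mul (X Y : coset0) : coset0 :=
  if (X, Y) is (Some x, Some y) then Some (x * y)%g else None.

(* Non-units are sent to None; in a division ring the only one is 0. *)
Definition coset_class (a : k) : coset0 :=
  omap \pi_(abelianization units)%qT (insub a : option units).

End Units.

Section DieudonneDeterminant.
Variables (k : unitRingType) (n : nat).

(* Row i is multiplied by mu from the left. *)
Definition scale_row (i : 'I_n) (mu : k) (A : 'M[k]_n) : 'M[k]_n :=
  \matrix_(r, c) (if r == i then mu * A r c else A r c).

(* mu times row i (from the left) is added to row j. *)
Definition add_row (i j : 'I_n) (mu : k) (A : 'M[k]_n) : 'M[k]_n :=
  \matrix_(r, c) (if r == j then A r c + mu * A i c else A r c).

(* Here mu ranges over all of k: the case mu = 0 of the first clause is what
   makes d vanish on singular matrices, and is needed for uniqueness. *)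
Record is_dieudonne_det (d : 'M[k]_n -> coset0 k) : Prop := IsDieudonneDet {
  dieudonne_scale : forall (A : 'M[k]_n) (i : 'I_n) (mu : k),
    d (scale_row i mu A) = coset0_mul (coset_class mu) (d A);
  dieudonne_add : forall (A : 'M[k]_n) (i j : 'I_n) (mu : k),
    i != j -> d (add_row i j mu A) = d A;
  dieudonne_1 : d 1%:M = coset_class 1
}.

End DieudonneDeterminant.

(* Main.v *)
Require Import Defs.
From mathcomp Require Import all_boot all_order all_algebra.
From mathcomp Require Import all_fingroup.
Import GRing.Theory.
Local Open Scope ring_scope.
Set Implicit Arguments.
Unset Strict Implicit.
Unset Printing Implicit Defensive.

(** Fix the rows of A below the first, forming an n x (n+1) matrix B, and let
    the first row a vary.  Then d(a) = det (a; B) does not change when a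
    combination of rows of B is added to a, and it scales by [mu] when a is
    multiplied by mu.  If the rows of B are left-dependent, d vanishes.
    Otherwise their span is a hyperplane, the kernel of a left-linear functional
    a |-> sum_i a_i f_i with f_j = 1 for some j, so that
    d(a) = [sum_i a_i f_i] d(e_j); absorbing into the f_i a representative c of
    the class d(e_j) gives lambda_i = f_i c, which depends on B alone
    ([dieudonne_linear_first_row]).

    Taking a = e_i shows that [lambda_i] = d(e_i), so what remains is the
    cofactor identity det (e_i; B) = [(-1)^i] det B^(i), where B^(i) is B
    without column i ([dieudonne_unit_first_row]).  Multiples of the first row
    clear the rest of column i, after which both sides depend on the minor B^(i)
    alone and react in the same way to row operations on it.  Gaussian
    elimination reduces to a permutation matrix s; bordering it gives the
    permutation matrix of a lift of s, whose signature is that of s times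
    (-1)^i.

    Both lemmas are proved by one induction principle, [gauss_ind], which is
    Gaussian elimination on the rows of a rectangular matrix. *)

(** * Coset classes *)

Section CosetClass.
Context {k : unitRingType}.
Implicit Types (X Y Z : coset0 k) (a b : k).

Lemma abelianizationC (G : groupType) (x y : abelianization G) :
  (x * y = y * x)%g.
Proof.
suff: ab_mul x y = ab_mul y x by [].
elim/quotW: x => x; elim/quotW: y => y; rewrite -!ab_piM.
apply/eqP/same_cosetP; rewrite invgM !mulgA.
exact: CommSubR.
Qed.

Lemma coset0_mulC X Y : coset0_mul X Y = coset0_mul Y X.
Proof. by case: X Y => [x|] [y|] //=; rewrite /coset0_mul abelianizationC. Qed.

Lemma coset0_mulA X Y Z :
  coset0_mul X (coset0_mul Y Z) = coset0_mul (coset0_mul X Y) Z.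
Proof. by case: X Y Z => [x|] [y|] [z|] //=; rewrite /coset0_mul mulgA. Qed.

Lemma coset0_mul0 X : coset0_mul X None = None.
Proof. by case: X. Qed.

Lemma coset_class0 : coset_class (0 : k) = None.
Proof. by rewrite /coset_class insubN ?unitr0. Qed.

Lemma coset_classM (hk : division_ring k) a b :
  coset_class (a * b) = coset0_mul (coset_class a) (coset_class b).
Proof.
have [->|a0] := eqVneq a 0; first by rewrite mul0r coset_class0.
have [->|b0] := eqVneq b 0; first by rewrite mulr0 coset_class0 coset0_mul0.
have [ua ub] := (hk _ a0, hk _ b0).
have uab : a * b \is a GRing.unit by rewrite unitrMr.
rewrite /coset_class !insubT /= -[RHS]/(Some (ab_mul _ _)) -ab_piM.
by congr (Some (\pi_(abelianization (units k)) _)%qT); apply: val_inj.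
Qed.

Lemma coset_class_surj X : exists a, coset_class a = X.
Proof.
case: X => [x|]; last by exists 0; apply: coset_class0.
elim/quotW: x => u; exists (\val u); rewrite /coset_class.
by rewrite valK.
Qed.

Lemma coset_class1M (hk : division_ring k) X : coset0_mul (coset_class 1) X = X.
Proof.
by have [a <-] := coset_class_surj X; rewrite -coset_classM // mul1r.
Qed.

End CosetClass.

(** * Row operations and Gaussian elimination *)

Section RowOperations.
Context {k : unitRingType} {m n : nat}.
Implicit Types (A : 'M[k]_(m, n)) (P : 'M[k]_(m, n) -> Prop).

(** On square matrices this and the next operation are convertible to
    [scale_row] and [add_row]; the rectangular form is what lets the rows below
    the first be reduced on their own. *)
Definition rect_scale_row (i : 'I_m) (mu : k) A : 'M[k]_(m, n) :=
  \matrix_(r, c) (if r == i then mu * A r c else A r c).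

Definition rect_add_row (i j : 'I_m) (mu : k) A : 'M[k]_(m, n) :=
  \matrix_(r, c) (if r == j then A r c + mu * A i c else A r c).

(** Only the direction from the reduced matrix back to the original one is
    asked for: it is the one used by elimination, and row additions being
    invertible, it entails the other. *)
Definition add_reflecting P : Prop :=
  forall A i j mu, i != j -> P (rect_add_row i j mu A) -> P A.

(** The additions are carried out one target row at a time; they do not
    interfere because the source row [i] is never modified. *)
Lemma add_reflecting_spread P (i : 'I_m) (f : 'I_m -> k) A :
  add_reflecting P ->
  P (\matrix_(r, c) (if r == i then A r c else A r c + f r * A i c)) -> P A.
Proof.
move=> addP PA.
suff H (s : seq 'I_m) : uniq s ->
  P (\matrix_(r, c) (if (r \in s) && (r != i) then A r c + f r * A i c
                     else A r c)) -> P A.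
  apply: (H (enum 'I_m)) (enum_uniq _) _; congr P: PA.
  by apply/matrixP => r c; rewrite !mxE mem_enum; case: eqVneq.
(* Each element of [s] costs one row addition; [uniq s] keeps a row from
   receiving its multiple of row [i] twice. *)
elim: s => [_|j s IHs /= /andP[js us]].
  by congr P; apply/matrixP => r c; rewrite !mxE.
move=> Pjs; apply: (IHs us).
have [ji|nji] := eqVneq j i.
  congr P: Pjs; apply/matrixP => r c; rewrite !mxE inE ji.
  by case: eqVneq => //; rewrite !andbF.
apply: (addP _ i j (f j)); first by rewrite eq_sym.
congr P: Pjs; apply/matrixP => r c; rewrite !mxE inE eqxx andbF.
by have [->|] := eqVneq r j; rewrite //= nji (negPf js).
Qed.

(** Dual to spreading: one target row, many source rows, none of which is
    modified on the way. *)
Lemma add_reflecting_gather P (i : 'I_m) (f : 'I_m -> k) A :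
  add_reflecting P ->
  P (\matrix_(r, c) (if r == i then A r c + \sum_(j | j != i) f j * A j c
                     else A r c)) -> P A.
Proof.
move=> addP.
elim: (index_enum _) => [|j s IHs].
  by congr P; apply/matrixP => r c; rewrite !mxE big_nil addr0 if_same.
move=> Pjs; apply: IHs; have [ji|nji] := eqVneq j i.
  congr P: Pjs; apply/matrixP => r c; rewrite !mxE big_cons ji eqxx.
  by case: eqVneq.
apply: (addP _ j i (f j)) => //.
congr P: Pjs; apply/matrixP => r c; rewrite !mxE big_cons nji (negPf nji).
by case: eqP => // _; rewrite [f j * _ + _]addrC addrA.
Qed.

Lemma pivot_columns_inj A (p : 'I_m -> 'I_n) :
  (forall r s, A r (p s) = (r == s)%:R) -> injective p.
Proof.
move=> pA r s prs; have := pA r s; rewrite -prs pA eqxx.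
by case: eqVneq => // _ /eqP; rewrite mulr1n oner_eq0.
Qed.

(** Elimination proceeds row by row, looking for a pivot anywhere in the current
    row and clearing the rest of its column.  Since the pivot columns are not
    moved into place, elimination needs no column operations and no row swaps;
    it stops at a zero row, or at a matrix whose columns [p 0, p 1, ...] form
    the identity matrix. *)
Lemma gauss_ind (hk : division_ring k) P :
    add_reflecting P ->
    (forall A i (mu : k), mu != 0 -> P (rect_scale_row i mu A) -> P A) ->
    (forall A i, (forall c, A i c = 0) -> P A) ->
    (forall A (p : 'I_m -> 'I_n),
       (forall r s, A r (p s) = (r == s)%:R) -> P A) ->
  forall A, P A.
Proof.
move=> addP scaleP zeroP pivP.
suff H t : forall A, (forall s : 'I_m, (s < m - t)%N ->
    exists c, forall r, A r c = (r == s)%:R) -> P A.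
  by move=> A; apply: (H m) => s; rewrite subnn.
(* [t] rows remain: rows 0 .. m - t - 1 already have their pivot column. *)
elim: t => [|t IHt] A piv.
  have [p pA] : exists p : 'I_m -> 'I_n, forall s r, A r (p s) = (r == s)%:R.
    apply: (fin_all_exists (P := fun s c => forall r, A r c = (r == s)%:R)) => s.
    by apply: piv; rewrite subn0.
  by apply: (pivP _ p) => r s; apply: pA.
have [le_mt|lt_tm] := leqP m t.
  apply: IHt => s; move: le_mt; rewrite -subn_eq0 => /eqP-> //.
have lt_m : (m - t.+1 < m)%N by rewrite ltn_subrL (leq_ltn_trans _ lt_tm).
pose i := Ordinal lt_m.
case: (pickP (fun c => A i c != 0)) => [c Aic|Ai0]; last first.
  by apply: (zeroP _ i) => c; have /negbFE/eqP := Ai0 c.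
have uA := hk _ Aic.
apply: (scaleP _ i (A i c)^-1); first by rewrite invr_eq0.
apply: (add_reflecting_spread (i := i) (f := fun r => - A r c)) => //.
apply: IHt => s; rewrite -subSS subSn // ltnS leq_eqVlt => /orP[/eqP si|lt_s].
  have {si}-> : s = i by apply: val_inj.
  exists c => r; rewrite !mxE eqxx mulVr // mulr1.
  by case: eqVneq => [->|_]; rewrite ?subrr // mulVr.
(* An earlier pivot column has a 0 in row [i], so it is left unchanged. *)
have [d Ad] := piv s lt_s; exists d => r.
have nis : i == s = false by apply: gtn_eqF.
rewrite !mxE eqxx !Ad nis !mulr0 addr0.
by case: eqVneq => [->|//]; rewrite nis mulr0.
Qed.

End RowOperations.

(** * Bordered matrices *)

Section Bordering.
Context {k : unitRingType}.

Definition cons_row {m n} (a : 'I_n -> k) (B : 'M[k]_(m, n)) : 'M[k]_(m.+1, n) :=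
  \matrix_(r, c) oapp (fun r' => B r' c) (a c) (unlift ord0 r).

Lemma cons_row0 m n (a : 'I_n -> k) (B : 'M[k]_(m, n)) c :
  cons_row a B ord0 c = a c.
Proof. by rewrite mxE unlift_none. Qed.

Lemma cons_rowS m n (a : 'I_n -> k) (B : 'M[k]_(m, n)) r c :
  cons_row a B (lift ord0 r) c = B r c.
Proof. by rewrite mxE liftK. Qed.

Lemma matrix_ordS m n (A B : 'M[k]_(m.+1, n)) :
  A ord0 =1 B ord0 -> (forall r c, A (lift ord0 r) c = B (lift ord0 r) c) ->
  A = B.
Proof.
by move=> eq0 eqS; apply/matrixP => r c; case: (unliftP ord0 r) => [r'|] ->.
Qed.

Lemma cons_row_row' m n (A : 'M[k]_(m.+1, n)) :
  A = cons_row (A ord0) (row' ord0 A).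
Proof.
by apply: matrix_ordS => [c|r c]; rewrite ?cons_row0 // cons_rowS mxE.
Qed.

Lemma rect_scale_row_cons_row m n (a : 'I_n -> k) (B : 'M[k]_(m, n)) i mu :
  rect_scale_row (lift ord0 i) mu (cons_row a B) = cons_row a (rect_scale_row i mu B).
Proof.
apply: matrix_ordS => [c|r c]; first by rewrite mxE !cons_row0.
by rewrite mxE !cons_rowS mxE (inj_eq lift_inj).
Qed.

Lemma rect_add_row_cons_row m n (a : 'I_n -> k) (B : 'M[k]_(m, n)) i j mu :
  rect_add_row (lift ord0 i) (lift ord0 j) mu (cons_row a B) =
    cons_row a (rect_add_row i j mu B).
Proof.
apply: matrix_ordS => [c|r c]; first by rewrite mxE !cons_row0.
by rewrite mxE !cons_rowS mxE (inj_eq lift_inj).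
Qed.

Definition insert_col0 {m n} (i : 'I_n.+1) (C : 'M[k]_(m, n)) : 'M[k]_(m, n.+1) :=
  \matrix_(r, c) oapp (C r) 0 (unlift i c).

Lemma rect_scale_row_insert_col0 m n i (C : 'M[k]_(m, n)) j mu :
  rect_scale_row j mu (insert_col0 i C) = insert_col0 i (rect_scale_row j mu C).
Proof.
apply/matrixP => r c; rewrite !mxE.
by case: (unliftP i c) => [c'|] _ /=; rewrite ?mxE ?mulr0 ?if_same.
Qed.

Lemma rect_add_row_insert_col0 m n i (C : 'M[k]_(m, n)) j l mu :
  rect_add_row j l mu (insert_col0 i C) = insert_col0 i (rect_add_row j l mu C).
Proof.
apply/matrixP => r c; rewrite !mxE.
by case: (unliftP i c) => [c'|] _ /=; rewrite ?mxE ?mulr0 ?addr0 ?if_same.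
Qed.

(** Bordering a permutation matrix by a unit row is what [lift_perm] does to
    the permutation; its known signature will yield the sign (-1)^i. *)
Lemma cons_row_insert_col0_perm n (i : 'I_n.+1) (s : 'S_n) :
  cons_row (fun c => (i == c)%:R) (insert_col0 i (perm_mx s)) =
    perm_mx (lift_perm ord0 i s) :> 'M[k]_n.+1.
Proof.
apply: matrix_ordS => [c|r c].
  by rewrite cons_row0 !mxE lift_perm_id.
rewrite cons_rowS !mxE lift_perm_lift.
case: (unliftP i c) => [c'|] -> /=; first by rewrite !mxE (inj_eq lift_inj).
by rewrite eq_sym (negPf (neq_lift _ _)).
Qed.

End Bordering.

(** * The Dieudonne determinant and its first row *)

Section DieudonneTheory.
Context {k : unitRingType} (hk : division_ring k).

Section OneSize.
Context {n : nat} {d : 'M[k]_n -> coset0 k} (hd : is_dieudonne_det d).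

(** A matrix with a zero row is unchanged when that row is multiplied by 0. *)
Lemma dieudonne_zero_row (A : 'M[k]_n) i : (forall c, A i c = 0) -> d A = None.
Proof.
move=> Ai0; suff <- : scale_row i 0 A = A.
  by rewrite (dieudonne_scale hd) coset_class0.
by apply/matrixP => r c; rewrite !mxE; case: eqP => // ->; rewrite mul0r Ai0.
Qed.

Lemma dieudonne_add_reflecting X : add_reflecting (fun A => d A = X).
Proof. by move=> A i j mu nij <-; rewrite -[LHS](dieudonne_add hd A mu nij). Qed.

(** Three additions turn the pair of rows (x, y) into (y, -x), and scaling by
    -1 finishes the swap. *)
Lemma dieudonne_xrow (A : 'M[k]_n) i j :
  i != j -> d (xrow i j A) = coset0_mul (coset_class (-1)) (d A).
Proof.
move=> nij; have nji : j != i by rewrite eq_sym.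
transitivity (d (scale_row j (-1)
  (add_row j i 1 (add_row i j (-1) (add_row j i 1 A))))); last first.
  by rewrite (dieudonne_scale hd) !(dieudonne_add hd).
congr d; apply/matrixP => r c; rewrite !mxE !eqxx.
have [->|nrj] := eqVneq r j.
  rewrite tpermR ?eqxx ?(negPf nij) ?(negPf nji) !mul1r !mulN1r.
  by rewrite opprB addrK.
have [->|nri] := eqVneq r i; last by rewrite tpermD // eq_sym.
rewrite tpermL ?eqxx ?(negPf nij) ?(negPf nji) !mul1r !mulN1r.
by rewrite addrC subrK.
Qed.

Lemma dieudonne_perm (s : 'S_n) : d (perm_mx s) = coset_class ((-1) ^+ s).
Proof.
case: (prod_tpermP s) => ts -> {s}.
elim: ts => [_|[i j] ts IHts /= /andP[nij /IHts{}IHts]].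
  by rewrite big_nil odd_perm1 expr0 perm_mx1 (dieudonne_1 hd).
rewrite big_cons odd_mul_tperm nij signr_addb /= coset_classM // -IHts.
rewrite perm_mxM -[perm_mx (tperm _ _)]/(tperm_mx _ _) -xrowE.
exact: dieudonne_xrow.
Qed.

End OneSize.

Context {n : nat} {d : 'M[k]_n -> coset0 k} {d1 : 'M[k]_n.+1 -> coset0 k}.
Context (hd : is_dieudonne_det d) (hd1 : is_dieudonne_det d1).

Lemma dieudonne_cons_row_scale a (B : 'M[k]_(n, n.+1)) i mu :
  d1 (cons_row a (rect_scale_row i mu B)) =
    coset0_mul (coset_class mu) (d1 (cons_row a B)).
Proof. by rewrite -rect_scale_row_cons_row; apply: (dieudonne_scale hd1). Qed.

Lemma dieudonne_cons_row_add a (B : 'M[k]_(n, n.+1)) i j mu :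
  i != j -> d1 (cons_row a (rect_add_row i j mu B)) = d1 (cons_row a B).
Proof.
by move=> nij; rewrite -rect_add_row_cons_row; apply: (dieudonne_add hd1).
Qed.

(** The existence of [lambda] is stable under row operations on [B]: scaling a
    row by [mu] only multiplies [lambda] by [mu] on the right, because classes
    commute.  For a reduced [B] with one column [j] left without a pivot, the
    multiples a_(p r) of row [r] of [B] are subtracted from [a], which becomes a
    left multiple of the unit row e_j. *)
Lemma dieudonne_linear_first_row (B : 'M[k]_(n, n.+1)) :
  exists lambda : 'I_n.+1 -> k, forall a,
    d1 (cons_row a B) = coset_class (\sum_i a i * lambda i).
Proof.
move: B; apply: (gauss_ind hk)
  => [B i j mu nij [l Hl]|B i mu mu0 [l Hl]|B i Bi0|B p pB].
- exists l => a.
  by rewrite -Hl dieudonne_cons_row_add.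
- exists (fun c => l c * mu^-1) => a.
  rewrite (eq_bigr (fun c => a c * l c * mu^-1)); last by move=> c; rewrite mulrA.
  rewrite -mulr_suml coset_classM // -Hl dieudonne_cons_row_scale coset0_mulC.
  by rewrite coset0_mulA -coset_classM // mulVr ?hk // coset_class1M.
- exists (fun=> 0) => a.
  rewrite big1 ?coset_class0; last by move=> c _; rewrite mulr0.
  by apply: (dieudonne_zero_row hd1 (i := lift ord0 i)) => c; rewrite cons_rowS.
have injp := pivot_columns_inj pB.
have [j jP] : exists j : 'I_n.+1, j \notin codom p.
  apply/existsP; rewrite -negb_forall; apply/forallP => allp.
  have := card_codom injp; rewrite card_ord => Hc.
  suff: #|codom p| = n.+1 by rewrite Hc => /n_Sn.
  by rewrite -[RHS]card_ord; apply: eq_card => x; rewrite allp.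
have codomp (c : 'I_n.+1) : c != j -> exists r, c = p r.
  move=> ncj; apply/codomP; apply/negPn/negP => ncp.
  have: (#|[predU1 c & [predU1 j & codom p]]| <= n.+1)%N.
    by rewrite -[X in (_ <= X)%N]card_ord max_card.
  by rewrite !cardU1 card_codom // card_ord !inE (negPf ncj) ncp jP ltnn.
(* The functional with value 1 at e_j that vanishes on the rows of [B] is
   x |-> x_j - sum_r x_(p r) B_(r,j); [c0] represents det (e_j; B). *)
have [c0 c0E] := coset_class_surj (d1 (cons_row (fun c => (c == j)%:R) B)).
exists (fun i => ((i == j)%:R - \sum_(r | p r == i) B r j) * c0) => a.
pose f := a j - \sum_r a (p r) * B r j.
have -> : \sum_i a i * (((i == j)%:R - \sum_(r | p r == i) B r j) * c0) = f * c0.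
  under eq_bigr => i _ do rewrite mulrA mulrBr.
  rewrite -mulr_suml sumrB; congr ((_ - _) * _).
    rewrite (bigD1 j) //= eqxx mulr1 big1 ?addr0 // => i /negPf->.
    by rewrite mulr0.
  under eq_bigr => i _ do rewrite mulr_sumr.
  rewrite (exchange_big_dep predT) //=; apply: eq_bigr => r _.
  by rewrite (big_pred1 (p r)) // => i; rewrite eq_sym.
rewrite coset_classM // c0E -(dieudonne_scale hd1 _ ord0).
(* The coefficient of row 0 itself is a dummy value. *)
pose g (r : 'I_n.+1) := oapp (fun r' => - a (p r')) 0 (unlift ord0 r).
apply: (add_reflecting_gather (P := fun M => d1 M = _) (i := ord0) (f := g));
  first exact: dieudonne_add_reflecting.
congr d1; apply: matrix_ordS => [c|r c]; rewrite !mxE ?eqxx; last first.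
  by rewrite liftK.
rewrite unlift_none /= big_mkcond big_ord_recl /= add0r.
under eq_bigr => r _ do rewrite /g liftK /= cons_rowS mulNr.
rewrite sumrN; have [->|/codomp[r ->]] := eqVneq c j; first by rewrite mulr1.
rewrite mulr0 (bigD1 r) //= pB eqxx mulr1 big1 ?addr0 ?subrr // => s /negPf nsr.
by rewrite pB nsr mulr0.
Qed.

(** Once column [i] is cleared below the first row, both sides are functions of
    the minor that obey the same rules for row operations and zero rows, so it
    is enough to compare them on permutation matrices. *)
Lemma dieudonne_unit_first_row (i : 'I_n.+1) (B : 'M[k]_(n, n.+1)) :
  d1 (cons_row (fun c => (i == c)%:R) B) =
    coset0_mul (coset_class ((-1) ^+ i)) (d (col' i B)).
Proof.
transitivity (d1 (cons_row (fun c => (i == c)%:R) (insert_col0 i (col' i B)))).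
  pose g (r : 'I_n.+1) := oapp (fun r' => - B r' i) 0 (unlift ord0 r).
  apply: (add_reflecting_spread (P := fun M => d1 M = _) (i := ord0) (f := g));
  first exact: dieudonne_add_reflecting.
  congr d1; apply: matrix_ordS => [c|r c]; rewrite [LHS]mxE ?eqxx ?cons_row0 //=.
  rewrite !cons_rowS /g liftK /= [RHS]mxE.
  case: (unliftP i c) => [c'|] -> /=; last by rewrite eqxx mulr1 subrr.
  by rewrite mxE (negPf (neq_lift _ _)) mulr0 addr0.
move: (col' i B) => {B}; apply: (gauss_ind hk)
  => [C j l mu njl|C j mu mu0|C j Cj0|C p pC].
- rewrite -rect_add_row_insert_col0 dieudonne_cons_row_add // => ->.
  by rewrite -(dieudonne_add hd C mu njl).
- rewrite -rect_scale_row_insert_col0 dieudonne_cons_row_scale => H.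
  have -> : d C = coset0_mul (coset_class mu^-1) (d (rect_scale_row j mu C)).
    rewrite [d (rect_scale_row _ _ _)](dieudonne_scale hd) coset0_mulA.
    by rewrite -coset_classM // mulVr ?hk // coset_class1M.
  rewrite coset0_mulA [coset0_mul (coset_class (_ ^+ _)) _]coset0_mulC.
  rewrite -coset0_mulA -H coset0_mulA -coset_classM // mulVr ?hk //.
  by rewrite coset_class1M.
- rewrite (dieudonne_zero_row hd Cj0) coset0_mul0.
  apply: (dieudonne_zero_row hd1 (i := lift ord0 j)) => c; rewrite cons_rowS mxE.
  by case: unlift => //= c'.
have injp := pivot_columns_inj pC.
have -> : C = perm_mx (perm injp).
  apply/matrixP => r c; rewrite !mxE permE.
  have [q _ pq] := injF_bij injp.
  by rewrite -(pq c) pC (inj_eq injp).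
rewrite cons_row_insert_col0_perm !dieudonne_perm // odd_lift_perm /=.
by rewrite signr_addb signr_odd coset_classM.
Qed.

End DieudonneTheory.

Unset Implicit Arguments.
Set Strict Implicit.

Theorem proposition2p4 (k : unitRingType) (hk : division_ring k)
    (det : forall m : nat, 'M[k]_m -> coset0 k)
    (hdet : forall m : nat, is_dieudonne_det (det m))
    (n : nat) (A : 'M[k]_n.+1) :
  exists lambda : 'I_n.+1 -> k,
    (forall A' : 'M[k]_n.+1, row' ord0 A' = row' ord0 A ->
       det n.+1 A' = coset_class (\sum_(i < n.+1) A' ord0 i * lambda i)) /\
    (forall i : 'I_n.+1,
       coset_class (lambda i)
       = coset0_mul (coset_class ((-1) ^+ i)) (det n (row' ord0 (col' i A)))).
Proof.
have [lambda Hl] := dieudonne_linear_first_row hk (hdet n.+1) (row' ord0 A).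
exists lambda; split=> [A' eqA|i].
  by rewrite {1}(cons_row_row' A') eqA Hl.
have -> : row' ord0 (col' i A) = col' i (row' ord0 A).
  by apply/matrixP => r c; rewrite !mxE.
rewrite -(dieudonne_unit_first_row hk (hdet n) (hdet n.+1)) Hl.
congr coset_class; rewrite (bigD1 i) //= eqxx mul1r big1 ?addr0 // => c.
by rewrite eq_sym => /negPf->; rewrite mul0r.
Qed.
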